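(* Let $(\tau_1,\tau_2)$ be a $\operatorname{CDPH}(\bm{\alpha},\bm{P},\bm{U},\bm{Q}_1,\bm{Q}_2)$ random vector. Then $\tau_{\max}:=\max\{\tau_1,\tau_2\}$ follows a $\operatorname{DPH}((\bm{\alpha},\bm{0},\bm{0},\bm{0}),\bm{P}_{\mathrm{max}})$ distribution and $\tau_{\min}:=\min\{\tau_1,\tau_2\}$ follows a $\operatorname{DPH}((\bm{\alpha},\bm{0}),\bm{P}_{\mathrm{min}})$ distribution, where $$\bm{P}_{\mathrm{max}}:=\begin{pmatrix}\bm{P}&\bm{U}^*&\bm{0}&\bm{0}\\ \bm{0}&\bm{Q}_1\otimes\bm{Q}_2&\bm{q}_1\otimes\bm{Q}_2&\bm{Q}_1\otimes\bm{q}_2\\ \bm{0}&\bm{0}&\bm{Q}_2&\bm{0}\\ \bm{0}&\bm{0}&\bm{0}&\bm{Q}_1\end{pmatrix},\qquad \bm{P}_{\mathrm{min}}:=\begin{pmatrix}\bm{P}&\bm{U}^*\\ \bm{0}&\bm{Q}_1\otimes\bm{Q}_2\end{pmatrix}.$$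
   Context: CDPH. $\mathcal{E}$ and $\mathcal{S}$ are disjoint nonempty finite sets. $\bm{\alpha}$ is a probability row vector indexed by $\mathcal{E}$; $\bm{P}$ is a subprobability matrix (nonnegative entries, row sums at most $1$) on $\mathcal{E}$; $\bm{U}=\{u_{ij}\}$ is a nonnegative $\mathcal{E}\times\mathcal{S}$ matrix such that each row of $(\bm{P}\ \bm{U})$ sums to one; $\bm{Q}_1,\bm{Q}_2$ are subprobability matrices on $\mathcal{S}$; $\bm{q}_k=\bm{1}-\bm{Q}_k\bm{1}$ for $k\in\{1,2\}$, where $\bm{1}$ is a column vector of ones. All chains terminate almost surely (from every state), i.e. all eigenvalues of $\bm{P},\bm{Q}_1,\bm{Q}_2$ have modulus strictly less than $1$. $M_1$ is a terminating Markov chain (time $n=0,1,2,\dots$) on $\mathcal{E}\cup\mathcal{S}$ with initial vector $(\bm{\alpha},\bm{0})$ and subprobability transition matrix $\begin{pmatrix}\bm{P}&\bm{U}\\ \bm{0}&\bm{Q}_1\end{pmatrix}$ (the missing mass in a row is the probability of terminating at the next step). Let $\tau_{1,2}:=\inf\{n\ge 1: M_1(n)\notin\mathcal{E}\}$. Set $M_2(n)=M_1(n)$ for $n\le\tau_{1,2}$; after time $\tau_{1,2}$, given the past up to $\tau_{1,2}$, $M_2$ evolves independently of $M_1$ as a terminating Markov chain in $\mathcal{S}$ with subprobability matrix $\bm{Q}_2$. For $k\in\{1,2\}$, $\tau_k:=\inf\{n\ge 1: M_k(n)\notin\mathcal{E}\cup\mathcal{S}\}$. The law of $(\tau_1,\tau_2)$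 is called $\operatorname{CDPH}(\bm{\alpha},\bm{P},\bm{U},\bm{Q}_1,\bm{Q}_2)$. $\operatorname{DPH}(\bm{\beta},\bm{T})$ is the law of the termination time $\inf\{n\ge1: M(n)\text{ has terminated}\}$ of a terminating Markov chain $M$ on a finite state space with initial probability vector $\bm{\beta}$ and subprobability transition matrix $\bm{T}$. $\otimes$ is the Kronecker product; $\mathcal{S}\times\mathcal{S}$ is ordered lexicographically; $\bm{U}^*=\{u^*_{i,(j_1,j_2)}\}_{i\in\mathcal{E},(j_1,j_2)\in\mathcal{S}\times\mathcal{S}}$ with $u^*_{i,(j_1,j_2)}:=u_{ij_1}\delta_{j_1,j_2}$ ($\delta$ the Kronecker delta). The blocks of $\bm{P}_{\mathrm{max}}$ correspond to the state space $\mathcal{E}\cup(\mathcal{S}\times\mathcal{S})\cup(\{\partial_1\}\times\mathcal{S})\cup(\mathcal{S}\times\{\partial_2\})$, where $\partial_1,\partial_2$ are extra symbols, and those of $\bm{P}_{\mathrm{min}}$ to $\mathcal{E}\cup(\mathcal{S}\times\mathcal{S})$. *)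

(* Defs.v *)
From HB Require Import structures.
From mathcomp Require Import all_boot all_order all_algebra.
From mathcomp Require Import complex.
From mathcomp Require Import all_classical all_reals all_analysis.
From mathcomp Require Import measurable_realfun.

Set Implicit Arguments.
Unset Strict Implicit.
Unset Printing Implicit Defensive.

Import Order.TTheory GRing.Theory Num.Theory.
Import numFieldNormedType.Exports.

Local Open Scope classical_set_scope.
Local Open Scope ring_scope.

(* Vectors and matrices are functions on arbitrary finite index types, so that
   a disjoint union of state spaces is a sum type and a Cartesian product is a
   product type.  Entries are addressed by their labels, so the ordering chosen
   to write a matrix down (e.g. the lexicographic one on S * S) plays no role. *)

Section Matrices.
Variable R : realType.

Definition vec (I : Type) := I -> R.
Definition mat (I J : Type) := I -> J -> R.

Definition zerov (I : Type) : vec I := fun _ => 0.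

Definition deltav (I : eqType) (i : I) : vec I := fun j => (i == j)%:R.

Definition catv (I J : Type) (u : vec I) (v : vec J) : vec (I + J) :=
  fun x => match x with inl i => u i | inr j => v j end.

Definition row4 (I1 I2 I3 I4 : Type)
    (u1 : vec I1) (u2 : vec I2) (u3 : vec I3) (u4 : vec I4) :
    vec (I1 + I2 + I3 + I4) :=
  catv (catv (catv u1 u2) u3) u4.

Definition kron (I1 J1 I2 J2 : Type) (A : mat I1 J1) (B : mat I2 J2) :
    mat (I1 * I2) (J1 * J2) :=
  fun p q => A p.1 q.1 * B p.2 q.2.

(* 1 - Q 1, as a matrix with a single column *)
Definition exit_col (I : finType) (Q : mat I I) : mat I unit :=
  fun i _ => 1 - \sum_j Q i j.

Definition probability_vec (I : finType) (b : vec I) : Prop :=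
  (forall i, 0 <= b i) /\ \sum_i b i = 1.

Definition subprobability_mat (I : finType) (T : mat I I) : Prop :=
  (forall i j, 0 <= T i j) /\ (forall i, \sum_j T i j <= 1).

Definition complex_mx (I : finType) (T : mat I I) : 'M[R[i]]_#|I| :=
  \matrix_(i, j) (T (enum_val i) (enum_val j))%:C%C.

(* almost sure termination from every state *)
Definition terminating (I : finType) (T : mat I I) : Prop :=
  forall z : R[i], eigenvalue (complex_mx T) z -> `|z| < 1.

End Matrices.

Arguments zerov R I%_type : clear implicits.

Section Chains.
Variable R : realType.
Variable Omega : Type.

(* A terminating process with state space X takes its values in option X, where
   None means that the process has terminated. *)

Definition init_law (X : Type) (b : vec R X) (x : option X) : R :=
  if x is Some i then b i else 0.

Definition step (X : finType) (T : mat R X X) (x y : option X) : R :=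
  match x, y with
  | Some i, Some j => T i j
  | Some i, None => 1 - \sum_j T i j
  | None, Some _ => 0
  | None, None => 1
  end.

Definition path_event (X : Type) (M : nat -> Omega -> X) (n : nat)
    (x : nat -> X) : set Omega :=
  [set w | forall k, (k <= n)%N -> M k w = x k].

Definition cond (mu : set Omega -> R) (A B : set Omega) : R :=
  mu (A `&` B) / mu A.

Definition is_chain (X : finType) (mu : set Omega -> R)
    (M : nat -> Omega -> option X) (b : vec R X) (T : mat R X X) : Prop :=
  (forall x, mu [set w | M 0%N w = x] = init_law b x) /\
  (forall n (x : nat -> option X) y, mu (path_event M n x) != 0 ->
     cond mu (path_event M n x) [set w | M n.+1 w = y] = step T (x n) y).

(* inf {n >= 1 : M(n) in C}, equal to +oo when there is no such n *)
Definition hitting_time (X : Type) (M : nat -> Omega -> X) (C : set X)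
    (w : Omega) : \bar R :=
  ereal_inf [set n%:R%:E | n in [set n : nat | (1 <= n)%N /\ C (M n w)]].

Definition termination_time (X : Type) (M : nat -> Omega -> option X) :
    Omega -> \bar R :=
  hitting_time M [set None].

End Chains.

Definition discrete_process d (Omega : measurableType d) (X : Type)
    (M : nat -> Omega -> X) : Prop :=
  forall n x, measurable [set w | M n w = x].

Definition same_law (R : realType) d1 (O1 : measurableType d1)
    (P1 : probability O1 R) d2 (O2 : measurableType d2)
    (P2 : probability O2 R) d (V : measurableType d)
    (f1 : O1 -> V) (f2 : O2 -> V) : Prop :=
  forall A : set V, measurable A -> P1 (f1 @^-1` A) = P2 (f2 @^-1` A).

Definition real_prob (R : realType) d (Omega : measurableType d)
    (Pr : probability Omega R) (A : set Omega) : R := fine (Pr A).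

Definition is_DPH (R : realType) d (Omega : measurableType d)
    (Pr : probability Omega R) (X : finType) (b : vec R X) (T : mat R X X)
    (tau : Omega -> \bar R) : Prop :=
  [/\ probability_vec b, subprobability_mat T, terminating T &
    exists (d' : measure_display) (Omega' : measurableType d')
      (Pr' : probability Omega' R) (M : nat -> Omega' -> option X),
      [/\ discrete_process M, is_chain (real_prob Pr') M b T &
          same_law Pr Pr' tau (termination_time R M)]].

Section CDPH.
Variables (R : realType) (E S : finType).
Variables (alpha : vec R E) (P : mat R E E) (U : mat R E S).
Variables (Q1 Q2 : mat R S S).

Definition M1_mat : mat R (E + S) (E + S) := fun x =>
  match x with
  | inl i => catv (P i) (U i)
  | inr j => catv (zerov R E) (Q1 j)
  end.

(* Q2 as a transition matrix on E + S: a chain in S is a chain in E + S that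
   starts in S and has these transitions. *)
Definition M2_mat : mat R (E + S) (E + S) := fun x =>
  match x with
  | inl _ => zerov R (E + S)
  | inr j => catv (zerov R E) (Q2 j)
  end.

Definition outside_E : set (option (E + S)) :=
  [set x | forall i : E, x <> Some (inl i)].

Definition tau12 (Omega : Type) (M1 : nat -> Omega -> option (E + S)) :
    Omega -> \bar R := hitting_time R M1 outside_E.

(* In the last field A is the event that the past up to tau12 is x_0, ..., x_m,
   with tau12 = m.  Given A, M2 started at time m is a chain with matrix Q2, and
   it is independent of M1 after time m.  The state x_m is almost surely in S,
   since the rows of (P U) sum to one. *)
Record CDPH_chains d (Omega : measurableType d) (Pr : probability Omega R)
    (M1 M2 : nat -> Omega -> option (E + S)) : Prop := {
  cdph_discrete1 : discrete_process M1;
  cdph_discrete2 : discrete_process M2;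
  cdph_chain1 :
    is_chain (real_prob Pr) M1 (catv alpha (zerov R S)) M1_mat;
  cdph_common : forall n w,
    (n%:R%:E <= tau12 M1 w)%E -> M2 n w = M1 n w;
  cdph_after : forall (m : nat) (x : nat -> option (E + S)) (j : S),
    let A := path_event M1 m x `&` [set w | tau12 M1 w = m%:R%:E] in
    let prA := cond (real_prob Pr) A in
    let N1 := fun k => M1 (m + k)%N in
    let N2 := fun k => M2 (m + k)%N in
    x m = Some (inr j) -> real_prob Pr A != 0 ->
    is_chain prA N2 (deltav R (inr j)) M2_mat /\
    (forall n y z,
       prA (path_event N1 n y `&` path_event N2 n z) =
       prA (path_event N1 n y) * prA (path_event N2 n z))
}.

Definition is_CDPH d (Omega : measurableType d) (Pr : probability Omega R)
    (tau1 tau2 : Omega -> \bar R) : Prop :=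
  exists (d' : measure_display) (Omega' : measurableType d')
    (Pr' : probability Omega' R) (M1 M2 : nat -> Omega' -> option (E + S)),
    CDPH_chains Pr' M1 M2 /\
    same_law Pr Pr' (fun w => (tau1 w, tau2 w))
      (fun w => (termination_time R M1 w, termination_time R M2 w)).

Definition Ustar : mat R E (S * S) := fun i p => U i p.1 * (p.1 == p.2)%:R.

(* unit * S stands for {d1} x S and S * unit for S x {d2}. *)
Definition Pmax : mat R (E + S * S + unit * S + S * unit)
                        (E + S * S + unit * S + S * unit) := fun x =>
  let O := zerov R in
  match x with
  | inl (inl (inl i)) => row4 (P i) (Ustar i) (O _) (O _)
  | inl (inl (inr p)) =>
      row4 (O E) (kron Q1 Q2 p) (kron (exit_col Q1) Q2 p)
        (kron Q1 (exit_col Q2) p)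
  | inl (inr (_, j)) => row4 (O E) (O _) (fun y => Q2 j y.2) (O _)
  | inr (j, _) => row4 (O E) (O _) (O _) (fun y => Q1 j y.1)
  end.

Definition Pmin : mat R (E + S * S) (E + S * S) := fun x =>
  match x with
  | inl i => catv (P i) (Ustar i)
  | inr p => catv (zerov R E) (kron Q1 Q2 p)
  end.

End CDPH.

(* Main.v *)
Require Import Defs.
From HB Require Import structures.
From mathcomp Require Import all_boot all_order all_algebra.
From mathcomp Require Import complex.
From mathcomp Require Import all_classical all_reals all_analysis.
From mathcomp Require Import measurable_realfun ring.

Set Implicit Arguments.
Unset Strict Implicit.
Unset Printing Implicit Defensive.

Import Order.TTheory GRing.Theory Num.Theory.
Import numFieldNormedType.Exports.

Local Open Scope classical_set_scope.
Local Open Scope ring_scope.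

(** Up to time tau12 the chains M1 and M2 agree and live in E; at that time they
    enter S at a common state j, and afterwards they are, conditionally on the
    past, independent chains with matrices Q1 and Q2.  Hence the pair (M1, M2)
    is itself Markov, and almost surely it only visits the pairs (i, i) with i in
    E and the pairs in (S + {terminated}) * (S + {terminated}).  These are the
    states of Pmax, its terminated state being the pair in which both chains have
    terminated.  The transition probabilities match: U^* sends E to the diagonal
    of S * S, a pair of independent steps has the product of the two step
    probabilities, and the mass missing from such a row of Pmax is the
    probability (1 - Q1 1)(1 - Q2 1) that both chains terminate.  The first time
    at which both chains have terminated is the maximum of tau1 and tau2.
    Merging all states in which some chain has terminated into a single
    terminated state gives a chain with matrix Pmin, whose termination time is
    the minimum.

    The process [max_process] combines M1 and M2 through the flags
    [terminated], which remember whether a chain has terminated so far.  These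
    flags make the two identities between termination times hold at every sample
    point, including the null set on which M1 or M2 leaves its terminated state.
    What remains is to compute laws of finite paths.  A path of positive
    probability stays in E to its end, or leaves it through the diagonal
    ([path_probM_split]); in the latter case its probability is computed by
    conditioning at tau12 ([split_path_prob]).  This only gives lower bounds for
    the laws of the finite paths of [max_process], as a path of [max_process] may
    come from several paths of (M1, M2); but the bounds sum to one, so that they
    are equalities ([path_prob_of_ge]).  The chain for the minimum is then a
    strong lumping of the chain for the maximum ([lumped_path_prob]).

    Termination of Pmax and Pmin is reduced to a statement on real vectors: a
    subprobability matrix T has spectral radius less than 1 as soon as, and only
    if, the only r >= 0 with r <= r T is 0.  This criterion passes easily
    through the block triangular structure, and through the Kronecker product by
    taking a marginal. *)

(** * Spectral radius and subinvariant vectors *)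

Section Termination.
Variables (R : realType) (I : finType) (T : mat R I I).

(** Summing r <= r T over all states, and using that the rows of T sum to at most
    1, shows that r = r T: a nonzero r would be an eigenvector for the
    eigenvalue 1. *)
Lemma terminating_subinvariant0 (r : vec R I) :
  subprobability_mat T -> terminating T ->
  (forall i, 0 <= r i) -> (forall j, r j <= \sum_i r i * T i j) ->
  forall i, r i = 0.
Proof.
move=> [T0 T1] Tt r0 rT.
have rowsum i : r i * (\sum_j T i j) <= r i by rewrite ler_piMr.
have rE j : \sum_i r i * T i j = r j.
  have d0 k : 0 <= \sum_i r i * T i k - r k by rewrite subr_ge0.
  have : \sum_k (\sum_i r i * T i k - r k) <= 0.
    rewrite sumrB exchange_big /= subr_le0; apply: ler_sum => i _.
    by rewrite -mulr_sumr.
  rewrite le_eqVlt ltNge sumr_ge0 // orbF psumr_eq0 // => /allP.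
  by move=> /(_ j (mem_index_enum _))/eqP/subr0_eq.
have [/forallP r00 i|] := boolP [forall i, r i == 0]; first exact/eqP.
rewrite negb_forall => /existsP[i ri].
have /Tt : eigenvalue (complex_mx T) 1.
  apply/eigenvalueP; exists (\row_k (r (enum_val k))%:C%C).
    apply/rowP => k; rewrite !mxE mul1r -[in RHS]rE rmorph_sum /=.
    rewrite [RHS](reindex _ (onW_bij _ (@enum_val_bij I))) /=.
    by apply: eq_bigr => l _; rewrite !mxE -rmorphM.
  apply: contra_neq ri => /rowP/(_ (enum_rank i)).
  by rewrite !mxE enum_rankK => -[].
by rewrite normr1 ltxx.
Qed.

(** If v T = z v with |z| >= 1, then |v| <= |z| |v| = |v T| <= |v| T entrywise, so
    that |v| is subinvariant. *)
Lemma terminating_of_subinvariant0 :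
  (forall i j, 0 <= T i j) ->
  (forall r : vec R I, (forall i, 0 <= r i) ->
     (forall j, r j <= \sum_i r i * T i j) -> forall i, r i = 0) ->
  terminating T.
Proof.
move=> T0 Tr z /eigenvalueP[v vT v0].
rewrite real_ltNge ?normr_real ?real1 //; apply/negP => z1.
pose r i := complex.Re `|v ord0 (enum_rank i)|.
have rE i : (r i)%:C%C = `|v ord0 (enum_rank i)|.
  rewrite /r; case: (`|_|) (normr_real (v ord0 (enum_rank i))) => a b /=.
  by rewrite complex_real => /eqP ->.
have r00 : forall i, r i = 0.
  apply: Tr => [i|j]; first by rewrite -lecR rE normr_ge0.
  rewrite -lecR rmorph_sum /= rE.
  have /rowP/(_ (enum_rank j)) := vT; rewrite !mxE => vTj.
  apply: (@le_trans _ _ `|z * v ord0 (enum_rank j)|).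
    by rewrite normrM ler_peMl.
  rewrite -vTj; apply: le_trans (ler_norm_sum _ _ _) _.
  rewrite [leRHS](reindex _ (onW_bij _ (@enum_val_bij I))) /=.
  apply: ler_sum => l _; rewrite !mxE enum_rankK normrM rmorphM /= rE enum_valK.
  by rewrite (ger0_norm (_ : 0 <= (T _ _)%:C%C)) ?ler0c.
move/eqP: v0; apply; apply/rowP => k; rewrite mxE.
by apply/eqP; rewrite -normr_eq0 -(enum_valK k) -rE r00.
Qed.

End Termination.

(** * The matrices of the maximum and of the minimum *)

Section Sums.
Variable R : realType.

Lemma sum_sumType (V : nmodType) (I J : finType) (F : I + J -> V) :
  \sum_x F x = \sum_i F (inl i) + \sum_j F (inr j).
Proof. exact: big_sumType. Qed.

Lemma sum_catv (I J : finType) (u : vec R I) (v : vec R J) :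
  \sum_x catv u v x = \sum_i u i + \sum_j v j.
Proof. exact: sum_sumType. Qed.

Lemma sum_pair (V : nmodType) (I J : finType) (F : I * J -> V) :
  \sum_p F p = \sum_i \sum_j F (i, j).
Proof. by rewrite pair_bigA; apply: eq_bigr => -[]. Qed.

Lemma sum_unit (V : nmodType) (F : unit -> V) : \sum_x F x = F tt.
Proof. by rewrite (big_pred1 tt) // => -[]. Qed.

Lemma sum_zerov (I : finType) : \sum_i zerov R I i = 0.
Proof. exact: big1. Qed.

Lemma sum_mulr0 (I : finType) (r : vec R I) : \sum_i r i * 0 = 0.
Proof. by rewrite -mulr_suml mulr0. Qed.

Lemma sum_kron (I J : finType) (A : mat R I I) (B : mat R J J) p :
  \sum_q kron A B p q = (\sum_i A p.1 i) * (\sum_j B p.2 j).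
Proof. by rewrite sum_pair big_distrlr. Qed.

End Sums.

Section BlockMatrices.
Variables (R : realType) (E S : finType).
Variables (P : mat R E E) (U : mat R E S) (Q1 Q2 : mat R S S).

Lemma sum_Ustar i : \sum_p Ustar U i p = \sum_j U i j.
Proof.
rewrite sum_pair; apply: eq_bigr => j _.
rewrite (bigD1 j) //= /Ustar /= eqxx mulr1 big1 ?addr0 // => k.
by rewrite eq_sym => /negPf ->; rewrite mulr0.
Qed.

(** From a pair of states in S, the row mass is the probability that at least one
    of two independent chains survives the step. *)
Lemma sum_Pmax x : \sum_y Pmax P U Q1 Q2 x y =
  match x with
  | inl (inl (inl i)) => \sum_k P i k + \sum_j U i j
  | inl (inl (inr (j1, j2))) =>
      1 - (1 - \sum_k Q1 j1 k) * (1 - \sum_k Q2 j2 k)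
  | inl (inr (_, j)) => \sum_k Q2 j k
  | inr (j, _) => \sum_k Q1 j k
  end.
Proof.
case: x => [[[i|[j1 j2]]|[[] j]]|[j []]];
  rewrite /Pmax /row4 !sum_catv ?sum_zerov ?addr0 ?add0r ?sum_Ustar //.
- rewrite sum_kron !sum_pair sum_unit /kron /exit_col /=.
  under [X in _ + _ + X]eq_bigr do rewrite sum_unit.
  by rewrite -mulr_sumr -mulr_suml; ring.
- by rewrite sum_pair sum_unit.
- by rewrite sum_pair; under eq_bigr do rewrite sum_unit.
Qed.

Lemma sum_Pmin x : \sum_y Pmin P U Q1 Q2 x y =
  match x with
  | inl i => \sum_k P i k + \sum_j U i j
  | inr (j1, j2) => (\sum_k Q1 j1 k) * (\sum_k Q2 j2 k)
  end.
Proof.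
by case: x => [i|[j1 j2]];
  rewrite /Pmin sum_catv ?sum_zerov ?add0r ?sum_Ustar ?sum_kron.
Qed.

Lemma mul_vec_Pmax r y : \sum_x r x * Pmax P U Q1 Q2 x y =
  match y with
  | inl (inl (inl k)) => \sum_i r (inl (inl (inl i))) * P i k
  | inl (inl (inr q)) => \sum_i r (inl (inl (inl i))) * Ustar U i q
      + \sum_p r (inl (inl (inr p))) * kron Q1 Q2 p q
  | inl (inr l) =>
      \sum_p r (inl (inl (inr p))) * kron (exit_col Q1) Q2 p l
      + \sum_j r (inl (inr (tt, j))) * Q2 j l.2
  | inr l => \sum_p r (inl (inl (inr p))) * kron Q1 (exit_col Q2) p l
      + \sum_j r (inr (j, tt)) * Q1 j l.1
  end.
Proof.
rewrite !sum_sumType [X in _ + X + _]sum_pair sum_unit [X in _ + X]sum_pair.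
under [X in _ + X]eq_bigr do rewrite sum_unit.
by case: y => [[[i|p]|l]|l] /=; rewrite /zerov !sum_mulr0 ?addr0 ?add0r.
Qed.

Lemma mul_vec_Pmin r y : \sum_x r x * Pmin P U Q1 Q2 x y =
  match y with
  | inl k => \sum_i r (inl i) * P i k
  | inr q => \sum_i r (inl i) * Ustar U i q + \sum_p r (inr p) * kron Q1 Q2 p q
  end.
Proof.
by rewrite sum_sumType; case: y => [i|p] /=; rewrite /zerov ?sum_mulr0 ?addr0.
Qed.

Hypotheses (hP : subprobability_mat P) (hU : forall i j, 0 <= U i j).
Hypothesis hPU : forall i, \sum_k P i k + \sum_j U i j = 1.
Hypotheses (hQ1 : subprobability_mat Q1) (hQ2 : subprobability_mat Q2).

Lemma exit_col_ge0 (Q : mat R S S) : subprobability_mat Q ->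
  forall i x, 0 <= exit_col Q i x.
Proof. by move=> [_ Q1'] i x; rewrite subr_ge0. Qed.

Lemma subprobability_Pmax : subprobability_mat (Pmax P U Q1 Q2).
Proof.
have [P0 _] := hP; have [Q10 Q11] := hQ1; have [Q20 Q21] := hQ2.
have q10 := exit_col_ge0 hQ1; have q20 := exit_col_ge0 hQ2.
split=> [x y|x].
  by case: x => [[[i|p]|[[] j]]|[j []]]; case: y => [[[k|q]|[[] l]]|[l []]];
    rewrite /= ?mulr_ge0 ?ler0n.
rewrite sum_Pmax; case: x => [[[i|[j1 j2]]|[[] j]]|[j []]] //.
  by rewrite hPU.
by rewrite gerBl mulr_ge0 // subr_ge0.
Qed.

Lemma subprobability_Pmin : subprobability_mat (Pmin P U Q1 Q2).
Proof.
have [P0 _] := hP; have [Q10 Q11] := hQ1; have [Q20 Q21] := hQ2.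
split=> [x y|x].
  by case: x => [i|p]; case: y => [k|q]; rewrite /= ?mulr_ge0 ?ler0n.
rewrite sum_Pmin; case: x => [i|[j1 j2]]; first by rewrite hPU.
by rewrite mulr_ile1 // sumr_ge0.
Qed.

Hypotheses (hPt : terminating P) (hQ1t : terminating Q1).
Hypothesis hQ2t : terminating Q2.

(** The second marginal of a subinvariant vector of the Kronecker product is
    subinvariant for Q2, because the rows of Q1 sum to at most 1. *)
Lemma kron_subinvariant0 (r : vec R (S * S)) : (forall p, 0 <= r p) ->
  (forall q, r q <= \sum_p r p * kron Q1 Q2 p q) -> forall p, r p = 0.
Proof.
move=> r0 rQ.
have [Q10 Q11] := hQ1; have [Q20 Q21] := hQ2.
have m0 : forall j2, \sum_j1 r (j1, j2) = 0.
  apply: (terminating_subinvariant0 hQ2 hQ2t) => [j|l2]; first exact: sumr_ge0.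
  apply: (@le_trans _ _
    (\sum_l1 \sum_j2 \sum_j1 r (j1, j2) * (Q1 j1 l1 * Q2 j2 l2))).
    apply: ler_sum => l1 _; apply: le_trans (rQ _) _.
    by rewrite sum_pair exchange_big.
  rewrite exchange_big /=; apply: ler_sum => j2 _.
  rewrite exchange_big mulr_suml /=; apply: ler_sum => j1 _.
  rewrite -mulr_sumr -mulr_suml ler_wpM2l //.
  by rewrite ler_piMl.
case=> j1 j2; apply/eqP; rewrite eq_le r0 andbT -(m0 j2).
by rewrite (bigD1 j1) //= lerDl sumr_ge0.
Qed.

(** The blocks are visited in the order of the block triangular structure: once r
    vanishes on the earlier blocks, its restriction to the next one is
    subinvariant for the diagonal block. *)
Lemma terminating_Pmax : terminating (Pmax P U Q1 Q2).
Proof.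
apply: terminating_of_subinvariant0; first by have [] := subprobability_Pmax.
move=> r r0 rT.
have rE i : r (inl (inl (inl i))) = 0.
  apply: (terminating_subinvariant0 hP hPt
    (r := fun i => r (inl (inl (inl i))))) => // {i} k.
  by apply: le_trans (rT _) _; rewrite mul_vec_Pmax.
have rSS p : r (inl (inl (inr p))) = 0.
  apply: (kron_subinvariant0 (r := fun p => r (inl (inl (inr p)))))
    => // {p} q.
  apply: le_trans (rT _) _; rewrite mul_vec_Pmax /=.
  by under eq_bigr do rewrite rE mul0r; rewrite big1 // add0r.
have r1 j : r (inl (inr (tt, j))) = 0.
  apply: (terminating_subinvariant0 hQ2 hQ2t (r := fun j => r (inl (inr (tt, j)))))
    => // {j} l.
  apply: le_trans (rT _) _; rewrite mul_vec_Pmax /=.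
  by under eq_bigr do rewrite rSS mul0r; rewrite big1 // add0r.
have r2 j : r (inr (j, tt)) = 0.
  apply: (terminating_subinvariant0 hQ1 hQ1t (r := fun j => r (inr (j, tt))))
    => // {j} l.
  apply: le_trans (rT _) _; rewrite mul_vec_Pmax /=.
  by under eq_bigr do rewrite rSS mul0r; rewrite big1 // add0r.
by case=> [[[i|p]|[[] j]]|[j []]].
Qed.

Lemma terminating_Pmin : terminating (Pmin P U Q1 Q2).
Proof.
apply: terminating_of_subinvariant0; first by have [] := subprobability_Pmin.
move=> r r0 rT.
have rE i : r (inl i) = 0.
  apply: (terminating_subinvariant0 hP hPt (r := fun i => r (inl i))) => // {i} k.
  by apply: le_trans (rT _) _; rewrite mul_vec_Pmin.
case=> // p.
apply: (kron_subinvariant0 (r := fun p => r (inr p))) => // {p} q.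
apply: le_trans (rT _) _; rewrite mul_vec_Pmin /=.
by under eq_bigr do rewrite rE mul0r; rewrite big1 // add0r.
Qed.

End BlockMatrices.

(** * Laws of finite paths *)

Lemma sum_option (V : nmodType) (X : finType) (F : option X -> V) :
  \sum_x F x = \sum_i F (Some i) + F None.
Proof.
rewrite addrC (bigD1 None) //=; congr (_ + _).
rewrite (reindex_omap Some id) /= => [|[]//].
by apply: eq_bigl => i; rewrite eqxx.
Qed.

Section RealProb.
Variables (R : realType) (d : measure_display) (Omega : measurableType d).
Variable Pr : probability Omega R.
Local Notation mu := (real_prob Pr).

Lemma real_prob_ge0 A : 0 <= mu A.
Proof. by rewrite fine_ge0. Qed.

Lemma real_prob_setT : mu setT = 1.
Proof. by rewrite /real_prob probability_setT. Qed.

Lemma le_real_prob A B : measurable A -> measurable B -> A `<=` B ->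
  mu A <= mu B.
Proof.
move=> mA mB AB; apply: fine_le; rewrite ?fin_num_measure //.
by apply: le_measure; rewrite ?inE.
Qed.

Lemma real_prob_partition (X : finType) (f : Omega -> X) B :
  (forall x, measurable [set w | f w = x]) -> measurable B ->
  mu B = \sum_x mu (B `&` [set w | f w = x]).
Proof.
move=> mf mB; have mBf x : measurable (B `&` [set w | f w = x]).
  exact: measurableI.
rewrite /real_prob sum_fine => [|x _]; last by rewrite fin_num_measure.
congr fine; rewrite fsbig_seq ?index_enum_uniq //.
rewrite -measure_fin_bigcup //; last first.
  by move=> x y _ _ [w [[_ <-] [_ <-]]].
congr (Pr _); apply/seteqP; split => [w Bw|w [x _ []]] //.
by exists (f w) => /=; [exact: mem_index_enum|].
Qed.

End RealProb.

Section MeasurableFiniteValued.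
Variables (d : measure_display) (Omega : measurableType d).

Lemma measurable_finite_comp (X : finType) (Y : Type) (f : Omega -> X)
    (g : X -> Y) :
  (forall x, measurable [set w | f w = x]) ->
  forall y, measurable [set w | g (f w) = y].
Proof.
move=> mf y; rewrite (_ : mkset _ =
  \bigcup_(x in [set x | g x = y]) [set w | f w = x]).
  by apply: fin_bigcup_measurable.
by apply/seteqP; split => [w ?|w [x /= <- <-]] //; exists (f w).
Qed.

Lemma measurable_finite_pair (X Y : Type) (f : Omega -> X) (g : Omega -> Y) :
  (forall x, measurable [set w | f w = x]) ->
  (forall y, measurable [set w | g w = y]) ->
  forall p, measurable [set w | (f w, g w) = p].
Proof.
move=> mf mg [x y].
rewrite (_ : mkset _ = [set w | f w = x] `&` [set w | g w = y]).
  exact: measurableI.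
by apply/seteqP; split => w /= [] // -> ->.
Qed.

End MeasurableFiniteValued.

Section PathEvents.
Variables (Omega X : Type) (M : nat -> Omega -> X).

Lemma path_event0 x : path_event M 0 x = [set w | M 0%N w = x 0%N].
Proof.
apply/seteqP; split => w /= Mx; first exact: Mx.
by move=> k; rewrite leqn0 => /eqP ->.
Qed.

Lemma path_eventS n x :
  path_event M n.+1 x = path_event M n x `&` [set w | M n.+1 w = x n.+1].
Proof.
apply/seteqP; split => w /= => [Mx|[Mx Mn] k].
  by split => [k kn|]; apply: Mx => //; exact: leqW.
by rewrite leq_eqVlt => /predU1P[->|/Mx].
Qed.

Lemma eq_path_event n x y : (forall k, (k <= n)%N -> x k = y k) ->
  path_event M n x = path_event M n y.
Proof.
by move=> xy; apply/seteqP; split => w /= Mx k kn; rewrite Mx // xy.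
Qed.

End PathEvents.

Lemma measurable_path_event d (Omega : measurableType d) (X : Type)
    (M : nat -> Omega -> X) n x :
  discrete_process M -> measurable (path_event M n x).
Proof.
move=> mM; elim: n => [|n IH]; first by rewrite path_event0.
by rewrite path_eventS; apply: measurableI.
Qed.

Section PathProbability.
Variables (R : realType) (X : finType) (b : vec R X) (T : mat R X X).

Definition path_prob n (x : nat -> option X) : R :=
  init_law b (x 0%N) * \prod_(0 <= k < n) step T (x k) (x k.+1).

Lemma path_prob0 x : path_prob 0 x = init_law b (x 0%N).
Proof. by rewrite /path_prob big_geq // mulr1. Qed.

Lemma path_probS n x :
  path_prob n.+1 x = path_prob n x * step T (x n) (x n.+1).
Proof. by rewrite /path_prob big_nat_recr //= mulrA. Qed.

Lemma eq_path_prob n x y : (forall k, (k <= n)%N -> x k = y k) ->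
  path_prob n x = path_prob n y.
Proof.
move=> xy; rewrite /path_prob xy //; congr (_ * _).
by apply: eq_big_nat => k /andP[_ kn]; rewrite !xy // ltnW.
Qed.

(** The definition of a chain constrains its transitions only after paths of
    nonzero probability, whence the hypothesis. Here mu is an arbitrary set
    function, so that the lemma also applies to a conditional probability. *)
Lemma chain_path_prob Omega (mu : set Omega -> R) M n x :
  is_chain mu M b T -> path_prob n x != 0 ->
  mu (path_event M n x) = path_prob n x.
Proof.
move=> [M0 MS]; elim: n => [|n IH]; first by rewrite path_event0 path_prob0 M0.
rewrite path_probS mulf_eq0 negb_or => /andP[pn sn].
have pE := IH pn.
rewrite -(MS n x (x n.+1)) ?pE // /cond pE mulrC divfK //.
by rewrite path_eventS.
Qed.

(** Two paths that agree up to time n have the same path event at time n, so the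
    path x can be continued by an arbitrary state y. *)
Lemma path_prob_chain Omega (mu : set Omega -> R) M :
  (forall n x, mu (path_event M n x) = path_prob n x) -> is_chain mu M b T.
Proof.
move=> ME; split=> [x|n x y mu0].
  by have := ME 0%N (fun=> x); rewrite path_event0 path_prob0.
pose x' k := if (k <= n)%N then x k else y.
have xx' k : (k <= n)%N -> x k = x' k by rewrite /x' => ->.
have x'n : x' n.+1 = y by rewrite /x' ltnn.
apply: (mulIf mu0); rewrite /cond divfK // mulrC.
rewrite (eq_path_event M xx') -[in LHS]x'n -path_eventS ME path_probS x'n.
by rewrite -xx' // ME.
Qed.

Hypothesis hb : probability_vec b.

Lemma sum_init_law : \sum_x init_law b x = 1.
Proof. by rewrite sum_option /= addr0; case: hb. Qed.

Lemma sum_step x : \sum_y step T x y = 1.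
Proof.
rewrite sum_option; case: x => [i|] /=; first by rewrite addrC subrK.
by rewrite big1 ?add0r.
Qed.

Variables (d : measure_display) (Omega : measurableType d).
Variables (Pr : probability Omega R) (M : nat -> Omega -> option X).
Hypothesis mM : discrete_process M.
Local Notation mu := (real_prob Pr).

(** Given equality at time n, the events at time n + 1 extending a path x split
    the event of x, and the lower bounds for them add up to its probability:
    no bound can be strict. *)
Lemma path_prob_of_ge :
  (forall n x, path_prob n x <= mu (path_event M n x)) ->
  forall n x, mu (path_event M n x) = path_prob n x.
Proof.
move=> Mge.
have eq_of_sum (F G : option X -> R) : (forall y, F y <= G y) ->
    \sum_y G y = \sum_y F y -> forall y, G y = F y.
  move=> FG /eqP; rewrite -subr_eq0 -sumrB psumr_eq0 => [/allP GF y|y _].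
    by apply/eqP; rewrite -subr_eq0; apply: GF; exact: mem_index_enum.
  by rewrite subr_ge0.
elim=> [|n IH] x.
  rewrite path_event0 path_prob0.
  apply: (eq_of_sum (init_law b) (fun y => mu [set w | M 0%N w = y])) => [y|].
    by have := Mge 0%N (fun=> y); rewrite path_event0 path_prob0.
  rewrite sum_init_law -(real_prob_setT Pr) (real_prob_partition _ (mM 0%N)) //.
  by apply: eq_bigr => y _; rewrite setTI.
rewrite path_eventS path_probS.
apply: (eq_of_sum (fun y => path_prob n x * step T (x n) y)
  (fun y => mu (path_event M n x `&` [set w | M n.+1 w = y]))) => [y|]; last first.
  rewrite -mulr_sumr sum_step mulr1 -IH -real_prob_partition //.
  exact: measurable_path_event.
pose x' k := if (k <= n)%N then x k else y.
have xx' k : (k <= n)%N -> x k = x' k by rewrite /x' => ->.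
have x'n : x' n.+1 = y by rewrite /x' ltnn.
have := Mge n.+1 x'; rewrite path_eventS path_probS x'n.
by rewrite -(eq_path_event M xx') -(eq_path_prob xx') -xx'.
Qed.

End PathProbability.

Lemma path_prob_neq0 (R : realType) (X : finType) (b : vec R X) (T : mat R X X)
    n x : path_prob b T n x != 0 -> init_law b (x 0%N) != 0 /\
    forall k, (k < n)%N -> step T (x k) (x k.+1) != 0.
Proof.
rewrite mulf_eq0 negb_or => /andP[-> sn]; split=> // k kn.
by move: sn; rewrite prodf_seq_neq0 => /allP/(_ k); rewrite mem_index_iota kn; apply.
Qed.

(** * Strong lumping *)

Section Lumping.
Variables (R : realType) (X Y : finType).
Variables (b : vec R X) (T : mat R X X) (b' : vec R Y) (T' : mat R Y Y).
Variable h : option X -> option Y.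
Hypothesis lump_init :
  forall y, \sum_(x | h x == y) init_law b x = init_law b' y.
Hypothesis lump_step :
  forall x y, \sum_(x' | h x' == y) step T x x' = step T' (h x) y.
Variables (d : measure_display) (Omega : measurableType d).
Variables (Pr : probability Omega R) (M : nat -> Omega -> option X).
Hypothesis mM : discrete_process M.
Local Notation mu := (real_prob Pr).
Hypothesis M_path : forall n x, mu (path_event M n x) = path_prob b T n x.

Local Notation hM := (fun n w => h (M n w)).

(** The probability that the lumped path up to time n is y and that the original
    chain is in state x at time n. *)
Fixpoint fiber_prob n (y : nat -> option Y) (x : option X) : R :=
  if h x == y n then
    if n is m.+1 then \sum_x0 fiber_prob m y x0 * step T x0 x
    else init_law b x
  else 0.

Lemma measurable_lumped : discrete_process hM.
Proof. by move=> n y; apply: measurable_finite_comp. Qed.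

(** A lumped past is a union of paths of M, so the chain property of M extends to
    it. Following a whole future path u, rather than a single transition, is
    what makes the induction on n work: moving one time step from the past
    to the future prepends a state to u. *)
Lemma lumped_path_then_path n m y u :
  mu (path_event hM n y `&` path_event (fun k => M (n + k)%N) m u) =
  fiber_prob n y (u 0%N) * \prod_(0 <= k < m) step T (u k) (u k.+1).
Proof.
elim: n m u => [|n IH] m u.
  rewrite path_event0 /=; case: eqP => hu; last first.
    rewrite mul0r (_ : _ `&` _ = set0) ?/real_prob ?measure0 //.
    apply/seteqP; split=> // w /= [hM0 /(_ 0%N isT) Mu].
    by apply: hu; rewrite -Mu.
  rewrite -/(path_prob b T m u) -M_path; congr mu.
  apply/seteqP; split=> w /= => [[_]//|Mu]; split=> //.
  by rewrite (Mu 0%N).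
rewrite path_eventS /=; case: eqP => hu; last first.
  rewrite mul0r (_ : _ `&` _ = set0) ?/real_prob ?measure0 //.
  apply/seteqP; split=> // w /= [[_ hMn] /(_ 0%N isT)]; rewrite addn0 => Mu.
  by apply: hu; rewrite -Mu.
rewrite mulr_suml.
rewrite (_ : _ `&` _ =
    path_event hM n y `&` path_event (fun k => M (n.+1 + k)%N) m u); last first.
  apply/seteqP; split=> w /= => [[[]]//|[My Mu]]; split=> //; split=> //.
  by have := Mu 0%N isT; rewrite addn0 => ->.
rewrite (real_prob_partition Pr (mM n)); last first.
  apply: measurableI; apply: measurable_path_event; first exact: measurable_lumped.
  by move=> k x; exact: mM.
apply: eq_bigr => x _.
pose v k := if k is l.+1 then u l else x.
rewrite -mulrA -(big_nat_recl _ _ (fun k => step T (v k) (v k.+1))) // -(IH _ v).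
congr mu; apply/seteqP; split=> w /=.
  move=> [[My Mu] Mx]; split=> // -[|k] km /=; first by rewrite addn0.
  by rewrite addnS -addSn Mu.
move=> [My Mv]; split; [split=> // k km|].
  by have := Mv k.+1 km; rewrite addnS -addSn.
by have := Mv 0%N isT; rewrite addn0.
Qed.

Lemma sum_fiber_prob n y : \sum_x fiber_prob n y x = path_prob b' T' n y.
Proof.
elim: n => [|n IH]; first by rewrite path_prob0 -lump_init [RHS]big_mkcond.
rewrite path_probS -IH mulr_suml /= -big_mkcond exchange_big /=.
apply: eq_bigr => x _; rewrite -mulr_sumr lump_step.
have [->//|hx] := eqVneq (h x) (y n).
suff -> : fiber_prob n y x = 0; first by rewrite !mul0r.
by case: n {IH} hx => [|n] /= /negPf ->.
Qed.

Lemma lumped_path_prob n y : mu (path_event hM n y) = path_prob b' T' n y.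
Proof.
rewrite (real_prob_partition Pr (mM n)); last first.
  by apply: measurable_path_event; exact: measurable_lumped.
rewrite -sum_fiber_prob; apply: eq_bigr => x _.
have := lumped_path_then_path n 0 y (fun=> x).
by rewrite path_event0 big_geq // mulr1 addn0.
Qed.

End Lumping.

(** * Hitting and termination times *)

Section HittingTimes.
Variables (R : realType) (Omega X : Type).
Implicit Types (M : nat -> Omega -> X) (C : set X) (w : Omega).

Lemma hitting_time_le M C w n : (0 < n)%N -> C (M n w) ->
  (hitting_time R M C w <= n%:R%:E)%E.
Proof. by move=> n0 Cn; apply: ereal_inf_lbound; exists n. Qed.

Lemma le_hitting_time M C w (t : \bar R) :
  (forall n, (0 < n)%N -> C (M n w) -> (t <= n%:R%:E)%E) ->
  (t <= hitting_time R M C w)%E.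
Proof. by move=> tC; apply: le_ereal_inf_tmp => _ [n [n0 Cn] <-]; exact: tC. Qed.

Lemma hitting_time_eq M C w n : (0 < n)%N -> C (M n w) ->
  (forall k, (0 < k < n)%N -> ~ C (M k w)) -> hitting_time R M C w = n%:R%:E.
Proof.
move=> n0 Cn Cl; apply/eqP; rewrite eq_le hitting_time_le //=.
apply: le_hitting_time => k k0 Ck; rewrite lee_fin ler_nat leqNgt.
by apply/negP => kn; apply: (Cl k) => //; rewrite k0.
Qed.

(** Times are natural numbers, so the infimum of a nonempty set of times is
    attained. *)
Lemma hitting_time_attained M C w : hitting_time R M C w = +oo%E \/
  exists n, [/\ (0 < n)%N, C (M n w) & hitting_time R M C w = n%:R%:E].
Proof.
have [[n [n0 Cn]]|nC] := pselect (exists n, (0 < n)%N /\ C (M n w)).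
  right; pose p k := (0 < k)%N && `[< C (M k w) >].
  have pn : exists k, p k by exists n; rewrite /p n0; apply/asboolP.
  case: (ex_minnP pn) => k /andP[k0 /asboolP Ck] kmin.
  exists k; split=> //; apply: hitting_time_eq => // l /andP[l0 lk] Cl.
  suff : (k <= l)%N by rewrite leqNgt lk.
  by apply: kmin; rewrite /p l0; apply/asboolP.
left; apply/eqP; rewrite -leye_eq; apply: le_hitting_time => n n0 Cn.
by case: nC; exists n.
Qed.

End HittingTimes.

Section Terminated.
Variables (R : realType) (Omega X : Type).

(** Time 0 is left out because termination times range over n >= 1. *)
Fixpoint terminated (M : nat -> Omega -> option X) n w : bool :=
  if n is m.+1 then terminated M m w || ~~ isSome (M n w) else false.

Lemma terminatedP M n w :
  reflect (exists k, (0 < k <= n)%N /\ M k w = None) (terminated M n w).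
Proof.
elim: n => [|n IH] /=; first by right=> -[k [/andP[k0]]]; rewrite leqNgt k0.
apply: (iffP orP) => [[/IH[k [/andP[k0 kn] Mk]]|Mn]|[k [/andP[k0]]]].
- by exists k; rewrite k0 leqW.
- by exists n.+1; split; [rewrite leqnn|case: (M n.+1 w) Mn].
rewrite leq_eqVlt => /predU1P[->->|kn Mk]; first by right.
by left; apply/IH; exists k; rewrite k0.
Qed.

Lemma termination_time_le M n w :
  terminated M n w -> (termination_time R M w <= n%:R%:E)%E.
Proof.
move=> /terminatedP[k [/andP[k0 kn] Mk]].
by apply: le_trans (hitting_time_le R k0 Mk) _; rewrite lee_fin ler_nat.
Qed.

Variables (Y : Type) (M1 M2 : nat -> Omega -> option X).
Variable Z : nat -> Omega -> option Y.
Local Notation T M := (termination_time R M).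

Lemma termination_time_max w :
  (forall n, Z n w = None <-> terminated M1 n w && terminated M2 n w) ->
  Order.max (T M1 w) (T M2 w) = T Z w.
Proof.
move=> ZE; apply/eqP; rewrite eq_le; apply/andP; split.
  apply: le_hitting_time => n n0 /ZE/andP[t1 t2].
  by rewrite ge_max !termination_time_le.
rewrite /termination_time.
have [->|[n1 [n10 Mn1 T1]]] := hitting_time_attained R M1 [set None] w.
  by rewrite le_max leey.
have [->|[n2 [n20 Mn2 T2]]] := hitting_time_attained R M2 [set None] w.
  by rewrite le_max leey orbT.
rewrite T1 T2 -EFin_max -natr_max maxEnat; apply: hitting_time_le.
  by rewrite leq_max n10.
apply/ZE/andP; split; apply/terminatedP.
  by exists n1; rewrite n10 leq_maxl.
by exists n2; rewrite n20 leq_maxr.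
Qed.

Lemma termination_time_min w :
  (forall n, Z n w = None <-> terminated M1 n w || terminated M2 n w) ->
  Order.min (T M1 w) (T M2 w) = T Z w.
Proof.
move=> ZE; apply/eqP; rewrite eq_le; apply/andP; split.
  apply: le_hitting_time => n n0 /ZE/orP[t1|t2].
    by rewrite ge_min termination_time_le.
  by rewrite ge_min (termination_time_le t2) orbT.
rewrite le_min; apply/andP; split; apply: le_hitting_time => n n0 Mn;
  apply: hitting_time_le => //; apply/ZE/orP; [left|right];
  by apply/terminatedP; exists n; rewrite n0 leqnn.
Qed.

End Terminated.

Lemma measurable_terminated d (Omega : measurableType d) (X : finType)
    (M : nat -> Omega -> option X) n (t : bool) :
  discrete_process M -> measurable [set w | terminated M n w = t].
Proof.
move=> mM; elim: n t => [|n IH] t.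
  by case: t; [rewrite (_ : mkset _ = set0)|rewrite (_ : mkset _ = setT)] => //;
    apply/seteqP; split.
exact: (measurable_finite_comp (f := fun w => (terminated M n w, M n.+1 w))
  (fun p => p.1 || ~~ isSome p.2) (measurable_finite_pair IH (mM n.+1))).
Qed.

(** * The two coordinates of a state of Pmax *)

Section MaxProcess.
Variables (R : realType) (E S : finType).
Variables (P : mat R E E) (U : mat R E S) (Q1 Q2 : mat R S S).

Local Notation state := (option (E + S)).
Local Notation max_state := (option (E + S * S + unit * S + S * unit)).

(** A state of Pmax encodes a pair of states of M1 and M2; a state in E stands
    for two equal coordinates. *)
Definition coord1 (z : max_state) : state :=
  match z with
  | Some (inl (inl (inl i))) => Some (inl i)
  | Some (inl (inl (inr (j, _)))) => Some (inr j)
  | Some (inr (j, _)) => Some (inr j)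
  | Some (inl (inr _)) | None => None
  end.

Definition coord2 (z : max_state) : state :=
  match z with
  | Some (inl (inl (inl i))) => Some (inl i)
  | Some (inl (inl (inr (_, j)))) => Some (inr j)
  | Some (inl (inr (_, j))) => Some (inr j)
  | Some (inr _) | None => None
  end.

(** The inverse encoding. The flags t1 and t2 tell whether the chains have
    terminated so far, and alone decide which chains count as terminated. The
    state j0 fills in for pairs of coordinates that occur with probability
    zero. *)
Definition combine (j0 : S) (c : bool * bool * (state * state)) : max_state :=
  let: (t1, t2, (x1, x2)) := c in
  let s x := if x is Some (inr j) then j else j0 in
  match t1, t2 with
  | true, true => None
  | true, false => Some (inl (inr (tt, s x2)))
  | false, true => Some (inr (s x1, tt))
  | false, false => Some (inl (inl
      (if x1 is Some (inl i) then inl i else inr (s x1, s x2))))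
  end.

(** The minimum is reached as soon as one chain has terminated. *)
Definition min_state (z : max_state) : option (E + S * S) :=
  if z is Some (inl (inl v)) then Some v else None.

Lemma combineK j0 z : combine j0
  (~~ isSome (coord1 z), ~~ isSome (coord2 z), (coord1 z, coord2 z)) = z.
Proof. by case: z => [[[[i|[j1 j2]]|[[] j]]|[j []]]|]. Qed.

Lemma combine_None j0 c : combine j0 c = None <-> c.1.1 && c.1.2.
Proof. by case: c => [[[] []] [x1 x2]]. Qed.

Lemma min_combine_None j0 c :
  min_state (combine j0 c) = None <-> c.1.1 || c.1.2.
Proof. by case: c => [[[] []] [x1 x2]]. Qed.

Definition in_E (z : max_state) : bool :=
  if z is Some (inl (inl (inl _))) then true else false.

Local Notation stepM := (step (Pmax P U Q1 Q2)).

Lemma sum_M1_mat x : \sum_y M1_mat P U Q1 x y =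
  match x with
  | inl i => \sum_k P i k + \sum_j U i j
  | inr j => \sum_k Q1 j k
  end.
Proof. by case: x => [i|j]; rewrite sum_catv ?sum_zerov ?add0r. Qed.

Lemma sum_M2_mat j : \sum_y M2_mat Q2 (inr j : E + S) y = \sum_k Q2 j k.
Proof. by rewrite sum_catv sum_zerov add0r. Qed.

Lemma step_coord1_None x y :
  stepM x y != 0 -> coord1 x = None -> coord1 y = None.
Proof.
by case: x y => [[[[i|[j1 j2]]|[[] j]]|[j []]]|]
  [[[[k|[l1 l2]]|[[] l]]|[l []]]|] //=; rewrite ?eqxx.
Qed.

Lemma step_coord2_None x y :
  stepM x y != 0 -> coord2 x = None -> coord2 y = None.
Proof.
by case: x y => [[[[i|[j1 j2]]|[[] j]]|[j []]]|]
  [[[[k|[l1 l2]]|[[] l]]|[l []]]|] //=; rewrite ?eqxx.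
Qed.

Lemma step_in_E x y : stepM x y != 0 -> in_E y -> in_E x.
Proof.
by case: x y => [[[[i|[j1 j2]]|[[] j]]|[j []]]|]
  [[[[k|[l1 l2]]|[[] l]]|[l []]]|] //=; rewrite ?eqxx.
Qed.

(** Outside E, Pmax is the transition matrix of two independent chains. *)
Lemma step_after_split x y : ~~ in_E x ->
  stepM x y = step (M1_mat P U Q1) (coord1 x) (coord1 y)
            * step (M2_mat Q2) (coord2 x) (coord2 y).
Proof.
case: x y => [[[[i|[j1 j2]]|[[] j]]|[j []]]|]
  [[[[k|[l1 l2]]|[[] l]]|[l []]]|] // _;
  rewrite /coord1 /coord2 /step ?sum_Pmax ?sum_M1_mat ?sum_M2_mat /=
    /zerov /kron /exit_col /= ?mul0r ?mulr0 ?mulr1 ?mul1r //.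
by rewrite opprB addrC subrK.
Qed.

Hypothesis hPU : forall i, \sum_k P i k + \sum_j U i j = 1.

(** No mass is lost from E because the rows of (P U) sum to one, and U^* charges
    only the diagonal. *)
Lemma step_from_E x y : in_E x -> stepM x y != 0 ->
  stepM x y = step (M1_mat P U Q1) (coord1 x) (coord1 y) /\
  (in_E y \/ exists j, y = Some (inl (inl (inr (j, j))))).
Proof.
case: x y => [[[[i|[j1 j2]]|[[] j]]|[j []]]|]
  [[[[k|[l1 l2]]|[[] l]]|[l []]]|] // _;
  rewrite /coord1 /coord2 /step ?sum_Pmax ?hPU ?subrr /= /zerov /Ustar /= ?eqxx //.
- by split; [|left].
- have [->|] := eqVneq l1 l2; last by rewrite mulr0 eqxx.
  by rewrite mulr1; split=> //; right; exists l2.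
Qed.

Variable alpha : vec R E.

Local Notation b := (row4 alpha (zerov R (S * S)) (zerov R (unit * S))
  (zerov R (S * unit))).
Local Notation path_probM := (path_prob b (Pmax P U Q1 Q2)).

Lemma init_in_E x : init_law b x != 0 -> in_E x.
Proof. by case: x => [[[[i|p]|p]|p]|] //=; rewrite eqxx. Qed.

Lemma init_law_coord1 x : in_E x ->
  init_law b x = init_law (catv alpha (zerov R S)) (coord1 x).
Proof. by case: x => [[[[i|p]|p]|p]|]. Qed.

Lemma path_probM_split n z : path_probM n z != 0 ->
  (forall k, (k <= n)%N -> in_E (z k)) \/
  exists m j, [/\ (0 < m <= n)%N, forall k, (k < m)%N -> in_E (z k),
    z m = Some (inl (inl (inr (j, j)))) &
    forall k, (m <= k <= n)%N -> ~~ in_E (z k)].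
Proof.
elim: n => [|n IH].
  rewrite path_prob0 => /init_in_E z0.
  by left=> k; rewrite leqn0 => /eqP ->.
rewrite path_probS mulf_eq0 negb_or => /andP[/IH pn sn].
case: pn => [zE|[m [j [/andP[m0 mn] zE zm zS]]]].
  have [_ [zE'|[j zj]]] := step_from_E (zE n (leqnn n)) sn.
    by left=> k; rewrite leq_eqVlt => /predU1P[->//|/zE].
  right; exists n.+1, j; split=> //; first by rewrite leqnn.
  by move=> k; rewrite -eqn_leq => /eqP <-; rewrite zj.
right; exists m, j; split=> //; first by rewrite m0 leqW.
move=> k /andP[mk]; rewrite leq_eqVlt => /predU1P[->|kn].
  by apply: contra (zS n _); [exact: step_in_E|rewrite mn leqnn].
by apply: zS; rewrite mk.
Qed.

End MaxProcess.

Arguments coord1 {E S} z.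
Arguments coord2 {E S} z.

(** * The chain of the maximum *)

Lemma terminated_path (Omega X : Type) (M : nat -> Omega -> option X) n x w :
  isSome (x 0%N) -> (forall k, (k < n)%N -> x k = None -> x k.+1 = None) ->
  path_event M n x w ->
  forall k, (k <= n)%N -> terminated M k w = ~~ isSome (x k).
Proof.
move=> x0 xN Mx; elim=> [|k IH] kn /=; first by rewrite x0.
rewrite IH ?(ltnW kn) // Mx //.
by case xk : (x k) => //=; rewrite xN.
Qed.

Section MaxChain.
Variables (R : realType) (E S : finType).
Variables (alpha : vec R E) (P : mat R E E) (U : mat R E S).
Variables (Q1 Q2 : mat R S S).
Hypothesis hPU : forall i, \sum_k P i k + \sum_j U i j = 1.

Local Notation b := (row4 alpha (zerov R (S * S)) (zerov R (unit * S))
  (zerov R (S * unit))).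
Local Notation path_probM := (path_prob b (Pmax P U Q1 Q2)).
Local Notation path_prob1 :=
  (path_prob (catv alpha (zerov R S)) (M1_mat P U Q1)).

Variables (d : measure_display) (Omega : measurableType d).
Variables (Pr : probability Omega R) (M1 M2 : nat -> Omega -> option (E + S)).
Hypothesis hM : CDPH_chains alpha P U Q1 Q2 Pr M1 M2.
Variable j0 : S.
Local Notation mu := (real_prob Pr).

Definition max_process n w := combine j0
  (terminated M1 n w, terminated M2 n w, (M1 n w, M2 n w)).

Lemma measurable_max_process : discrete_process max_process.
Proof.
case: hM => mM1 mM2 _ _ _ n.
apply: measurable_finite_comp; apply: measurable_finite_pair.
  by apply: measurable_finite_pair => t; apply: measurable_terminated.
exact: measurable_finite_pair.
Qed.

(** Along a path of positive probability a terminated coordinate stays so,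
    hence the flags agree with the coordinates themselves. *)
Lemma coord_paths_max_process n z : path_probM n z != 0 ->
  path_event M1 n (coord1 \o z) `&` path_event M2 n (coord2 \o z)
  `<=` path_event max_process n z.
Proof.
move=> /path_prob_neq0[/init_in_E z0 zS] w [w1 w2] k kn.
rewrite /max_process (terminated_path _ _ w1) //; last first.
- by move=> l ln; apply: step_coord1_None (zS _ ln).
- by move: z0; rewrite /=; case: (z 0%N) => [[[[]|]|]|].
rewrite (terminated_path _ _ w2) //; last first.
- by move=> l ln; apply: step_coord2_None (zS _ ln).
- by move: z0; rewrite /=; case: (z 0%N) => [[[[]|]|]|].
by rewrite w1 // w2 // combineK.
Qed.

Lemma coord_in_E x : in_E x ->
  coord2 x = coord1 x /\ ~ @outside_E E S (coord1 x).
Proof. by case: x => [[[[i|]|]|]|] //= _; split=> // /(_ i). Qed.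

(** A path inside E has tau12 beyond its end, so that M2 is a copy of M1. *)
Lemma common_path_prob n z : path_probM n z != 0 ->
  (forall k, (k <= n)%N -> in_E (z k)) ->
  mu (path_event M1 n (coord1 \o z) `&` path_event M2 n (coord2 \o z)) =
  path_probM n z.
Proof.
move=> pz zE; have [_ zS] := path_prob_neq0 pz.
have pE : path_probM n z = path_prob1 n (coord1 \o z).
  rewrite /path_prob init_law_coord1 ?zE //; congr (_ * _).
  apply: eq_big_nat => k /andP[_ kn].
  by have [] := step_from_E hPU (zE k (ltnW kn)) (zS k kn).
have [_ _ hc1 hcom _] := hM.
rewrite pE -(chain_path_prob hc1) -?pE //; congr mu.
apply/seteqP; split=> w /= => [[]//|w1]; split=> // k kn.
rewrite hcom ?w1 //=; first by have [->] := coord_in_E (zE k kn).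
apply: le_hitting_time => l l0 Cl; rewrite lee_fin ler_nat leqNgt.
apply/negP => lk; have ln : (l <= n)%N by rewrite (leq_trans (ltnW lk)).
by rewrite w1 // in Cl; have [_] := coord_in_E (zE l ln); apply.
Qed.

(** Let the path leave E at time m, through (j, j). On its event tau12 = m, so its
    probability is that of the past A up to m times the conditional probability
    of the two futures; by independence, the first future together with A gives
    the law of a path of M1, and the second one that of a chain with matrix Q2.
    The step probabilities factor in the same way. *)
Lemma split_path_prob n z m j : path_probM n z != 0 ->
  (0 < m <= n)%N -> (forall k, (k < m)%N -> in_E (z k)) ->
  z m = Some (inl (inl (inr (j, j)))) ->
  (forall k, (m <= k <= n)%N -> ~~ in_E (z k)) ->
  mu (path_event M1 n (coord1 \o z) `&` path_event M2 n (coord2 \o z)) =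
  path_probM n z.
Proof.
move=> pz /andP[m0 mn] zE zm zN; have [_ zS] := path_prob_neq0 pz.
set x1 := coord1 \o z; set x2 := coord2 \o z.
pose y1 k := x1 (m + k)%N; pose y2 k := x2 (m + k)%N.
(* The law of the second future, a chain with matrix Q2 started at j. *)
pose p2 := path_prob (deltav R (inr j : E + S)) (M2_mat Q2) (n - m) y2.
have pE : path_probM n z = path_prob1 n x1 * p2.
  have -> : p2 = \prod_(m <= k < n) step (M2_mat Q2) (x2 k) (x2 k.+1).
    rewrite /p2 /path_prob /y2 /= addn0 /x2 /= zm /= /deltav eqxx mul1r.
    rewrite -[in RHS](add0n m) big_addn; apply: eq_bigr => k _.
    by rewrite addnS addnC.
  rewrite /path_prob init_law_coord1 ?zE // -!mulrA; congr (_ * _).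
  rewrite !(big_cat_nat (leq0n m) mn) /= -mulrA -big_split /=; congr (_ * _).
    apply: eq_big_nat => k /andP[_ km].
    by have [] := step_from_E hPU (zE k km) (zS k (leq_trans km mn)).
  apply: eq_big_nat => k /andP[mk kn].
  by rewrite step_after_split // zN // mk ltnW.
have : path_prob1 n x1 * p2 != 0 by rewrite -pE.
rewrite mulf_eq0 negb_or => /andP[p10 p20].
have [_ _ hc1 hcom haft] := hM.
have tauE w : path_event M1 m x1 w -> tau12 R M1 w = m%:R%:E.
  move=> w1; apply: hitting_time_eq => //.
    by rewrite w1 // /x1 /= zm => i.
  move=> k /andP[_ km]; rewrite w1 ?(ltnW km) // /x1 /=.
  by have [] := coord_in_E (zE k km).
pose A := path_event M1 m x1 `&` [set w | tau12 R M1 w = m%:R%:E].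
have AE : A = path_event M1 m x1.
  by apply/seteqP; split=> w => [[]//|w1]; split=> //; exact: tauE.
have p1m : path_prob1 m x1 != 0.
  move: p10; rewrite /path_prob (big_cat_nat (leq0n m) mn) /= mulrA mulf_eq0.
  by rewrite negb_or => /andP[].
have muA : mu A != 0 by rewrite AE (chain_path_prob hc1).
have x1m : x1 m = Some (inr j) by rewrite /x1 /= zm.
have [hc2 hind] := haft m x1 j x1m muA.
set N1 := fun k => M1 (m + k)%N in hind.
set N2 := fun k => M2 (m + k)%N in hc2 hind.
(* The first future together with the past is a path of M1. *)
have A1 : A `&` path_event N1 (n - m) y1 = path_event M1 n x1.
  rewrite AE; apply/seteqP; split=> w /= => [[wA w1] k kn|w1].
    have [/wA //|mk] := leqP k m.
    have := w1 (k - m)%N.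
    by rewrite /N1 /y1 subnKC ?(ltnW mk) // leq_sub2r //; apply.
  split=> k km; first by rewrite w1 // (leq_trans km).
  by rewrite /N1 /y1 w1 // -(subnKC mn) leq_add2l.
(* Before time m the path of M2 is forced by that of M1. *)
have A12 : path_event M1 n x1 `&` path_event M2 n x2 =
    A `&` (path_event N1 (n - m) y1 `&` path_event N2 (n - m) y2).
  rewrite setIA A1; apply/seteqP; split=> w /= [w1 w2]; split=> // k km.
    by rewrite /N2 /y2 w2 // -(subnKC mn) leq_add2l.
  have [lekm|mk] := leqP k m; last first.
    have := w2 (k - m)%N.
    by rewrite /N2 /y2 subnKC ?(ltnW mk) // leq_sub2r //; apply.
  have tw : tau12 R M1 w = m%:R%:E.
    by apply: tauE => l lm; rewrite w1 // (leq_trans lm).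
  rewrite hcom ?tw ?lee_fin ?ler_nat // w1 // /x1 /x2 /=.
  move: lekm; rewrite leq_eqVlt => /predU1P[->|/zE /coord_in_E[]//].
  by rewrite zm.
rewrite A12 pE.
have := hind (n - m)%N y1 y2.
rewrite (chain_path_prob hc2) // -/p2 /cond A1 => /(congr1 (fun t => mu A * t)).
rewrite mulrC divfK // => ->.
by rewrite mulrA (mulrC (mu A)) divfK // (chain_path_prob hc1).
Qed.

Hypothesis halpha : probability_vec alpha.

Lemma probability_row4 : probability_vec b.
Proof.
have [a0 a1] := halpha; split; last by rewrite !sum_catv !sum_zerov !addr0.
by case=> [[[]|]|] //=.
Qed.

Lemma max_process_path_prob n z :
  mu (path_event max_process n z) = path_probM n z.
Proof.
apply: path_prob_of_ge => {n z}.
- exact: probability_row4.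
- exact: measurable_max_process.
move=> n z; have [->|pz] := eqVneq (path_probM n z) 0.
  exact: real_prob_ge0.
have [mM1 mM2 _ _ _] := hM.
apply: le_trans (le_real_prob Pr _ _ (coord_paths_max_process pz)); last first.
- by apply: measurable_path_event; exact: measurable_max_process.
- by apply: measurableI; exact: measurable_path_event.
have [zE|[m [j [mn zE zm zN]]]] := path_probM_split hPU pz.
  by rewrite common_path_prob.
by rewrite (split_path_prob pz mn zE zm zN).
Qed.

End MaxChain.

(** * The chain of the minimum *)

Section MinLumping.
Variables (R : realType) (E S : finType).
Variables (alpha : vec R E) (P : mat R E E) (U : mat R E S).
Variables (Q1 Q2 : mat R S S).

(** Only the fiber of the terminated state has several elements, and its mass is
    determined by the other ones and the total. *)
Lemma min_state_fiber_sum (F : option (E + S * S + unit * S + S * unit) -> R)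
    (G : option (E + S * S) -> R) :
  (forall v, F (Some (inl (inl v))) = G (Some v)) ->
  \sum_x F x = \sum_y G y ->
  forall y, \sum_(x | min_state x == y) F x = G y.
Proof.
move=> FG sumFG.
have someE v : \sum_(x | min_state x == Some v) F x = G (Some v).
  rewrite (big_pred1 (Some (inl (inl v)))) // => -[[[u|p]|p]|] //=.
case=> //; move: sumFG; rewrite (partition_big (@min_state E S) xpredT) //=.
by rewrite !sum_option (eq_bigr _ (fun v _ => someE v)) => /addrI.
Qed.

Lemma sum_step_min_state x y :
  \sum_(x' | min_state x' == y) step (Pmax P U Q1 Q2) x x' =
  step (Pmin P U Q1 Q2) (min_state x) y.
Proof.
apply: min_state_fiber_sum; last by rewrite !sum_step.
by move=> v; case: x => [[[[i|p]|[[] j]]|[j []]]|]; case: v => [k|q].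
Qed.

Lemma sum_init_min_state y :
  \sum_(x | min_state x == y) init_law (row4 alpha (zerov R (S * S))
    (zerov R (unit * S)) (zerov R (S * unit))) x =
  init_law (catv alpha (zerov R (S * S))) y.
Proof.
apply: min_state_fiber_sum => //.
by rewrite !sum_option /row4 !sum_catv !sum_zerov !addr0.
Qed.

End MinLumping.

Lemma same_law_comp (R : realType) d1 (O1 : measurableType d1)
    (P1 : probability O1 R) d2 (O2 : measurableType d2)
    (P2 : probability O2 R) d (V : measurableType d) d' (W : measurableType d')
    (f1 : O1 -> V) (f2 : O2 -> V) (g : V -> W) :
  measurable_fun setT g -> same_law P1 P2 f1 f2 ->
  same_law P1 P2 (g \o f1) (g \o f2).
Proof.
move=> mg f12 A mA; apply: (f12 (g @^-1` A)).
by rewrite -[X in measurable X]setTI; apply: mg.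
Qed.

Theorem proposition2p6 (R : realType) (E S : finType)
    (alpha : vec R E) (P : mat R E E) (U : mat R E S) (Q1 Q2 : mat R S S)
    (hE : (0 < #|E|)%N) (hS : (0 < #|S|)%N)
    (halpha : probability_vec alpha)
    (hP : subprobability_mat P)
    (hU : forall i j, 0 <= U i j)
    (hPU : forall i, \sum_k P i k + \sum_j U i j = 1)
    (hQ1 : subprobability_mat Q1) (hQ2 : subprobability_mat Q2)
    (hPt : terminating P) (hQ1t : terminating Q1) (hQ2t : terminating Q2)
    (d : measure_display) (Omega : measurableType d)
    (Pr : probability Omega R) (tau1 tau2 : {RV Pr >-> \bar R})
    (htau : is_CDPH alpha P U Q1 Q2 Pr tau1 tau2) :
  is_DPH Pr
    (row4 alpha (zerov R (S * S)) (zerov R (unit * S)) (zerov R (S * unit)))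
    (Pmax P U Q1 Q2) (fun w => Order.max (tau1 w) (tau2 w)) /\
  is_DPH Pr (catv alpha (zerov R (S * S)))
    (Pmin P U Q1 Q2) (fun w => Order.min (tau1 w) (tau2 w)).
Proof.
have [j0 _] : exists j : S, true by case/card_gt0P: hS => j _; exists j.
case: htau => dW [W [PW [M1 [M2 [hM hlaw]]]]].
have mZ := measurable_max_process hM j0.
have ZE := max_process_path_prob hPU hM j0 halpha.
split; split.
- exact: probability_row4.
- exact: subprobability_Pmax.
- exact: terminating_Pmax.
- exists dW, W, PW, (max_process M1 M2 j0); split=> //.
    exact: path_prob_chain.
  have := same_law_comp (measurable_maxe measurable_fst measurable_snd) hlaw.
  congr (same_law _ _ _ _); apply/funext => w /=.
  by apply: termination_time_max => n; exact: combine_None.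
- have [a0 a1] := halpha; split; last by rewrite sum_catv sum_zerov addr0.
  by case.
- exact: subprobability_Pmin.
- exact: terminating_Pmin.
- exists dW, W, PW, (fun n w => min_state (max_process M1 M2 j0 n w)).
  split; first exact: measurable_lumped.
    apply: path_prob_chain => n y.
    apply: (lumped_path_prob _ _ mZ ZE).
    + exact: sum_init_min_state.
    + exact: sum_step_min_state.
  have := same_law_comp (measurable_mine measurable_fst measurable_snd) hlaw.
  congr (same_law _ _ _ _); apply/funext => w /=.
  by apply: termination_time_min => n; exact: min_combine_None.
Qed.
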